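(* Let $\sigma$ be a uniformly random permutation in $\mathfrak{S}_n$, and let $P_n=(d_{i-j})_{1\le i,j\le n}$ be the Toeplitz matrix of displacement counts of $\sigma$. The expected Toeplitz matrix normalized by $n$ is given by $$\mathbb{E}\Big[\frac{1}{n}P_n(i,j)\Big]=1-\frac{|i-j|}{n},\qquad 1\le i,j\le n.$$
   Context: $\mathfrak{S}_n$ is the set of permutations of $\{1,\dots,n\}$. For $\sigma\in\mathfrak{S}_n$, the displacement of the index $i$ is $\delta_i=i-\sigma(i)$, and the displacement counts are $d_k=|\{i\in\{1,\dots,n\}:\delta_i=k\}|$ for $-(n-1)\le k\le n-1$. The matrix $P_n$ has $(i,j)$ entry $P_n(i,j)=d_{i-j}$. The expectation $\mathbb{E}$ is over the uniformly random permutation $\sigma$.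
   Formalization: The printed formula is false for n ≥ 2 (for n = 2, i = j the left side is 1/2, the right side 1); the right side is corrected to (1/n)(1 − |i−j|/n), i.e. E[P_n(i,j)] = 1 − |i−j|/n. *)

(* Defs.v *)
From mathcomp Require Import all_boot all_order all_algebra all_fingroup.

Set Implicit Arguments.
Unset Strict Implicit.
Unset Printing Implicit Defensive.

Import GRing.Theory Num.Theory.
Local Open Scope ring_scope.

(* {1, ..., n} is encoded as 'I_n = {0, ..., n-1}: displacements and
   differences of indices do not depend on this shift. *)

Definition displacement (n : nat) (s : 'S_n) (i : 'I_n) : int :=
  (i : nat)%:Z - (s i : nat)%:Z.

(* Total in k : int; the value is 0 when n <= `|k|. *)
Definition displacement_count (n : nat) (s : 'S_n) (k : int) : nat :=
  #|[set i : 'I_n | displacement s i == k]|.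

Definition displacement_toeplitz (R : realFieldType) (n : nat) (s : 'S_n) :
    'M[R]_n :=
  \matrix_(i < n, j < n)
    (displacement_count s ((i : nat)%:Z - (j : nat)%:Z))%:R.

Definition uniform_expectation (R : realFieldType) (T : finType) (X : T -> R) : R :=
  (\sum_(t : T) X t) / #|T|%:R.

(* Main.v *)
Require Import Defs.
From mathcomp Require Import all_boot all_order all_algebra all_fingroup.
From mathcomp Require Import zify.
Import GRing.Theory Num.Theory.
Local Open Scope ring_scope.

(** The count [displacement_count s k] is the number of points that the graph
    of [s] has in common with the diagonal [a - b = k] of the square of
    indices. A uniformly random permutation sends a given [a] to each of the
    [n] possible values with probability [1 / n], so by linearity of
    expectation its graph meets any set [A] of pairs in [#|A| / n] points on
    average ([expected_graph_meet]). The diagonal at [k] has [n - |k|] cells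
    ([card_diagonal]), whence the expected count is [(n - |k|) / n]; the factor
    [n^-1] in front comes from the normalization of the matrix. *)

(** Composing with the transposition of [b] and [c] exchanges the permutations
    sending [a] to [b] with those sending [a] to [c], so these [#|T|] classes,
    which partition the permutations, all have the same size. *)
Lemma card_perm_sending (T : finType) (a b : T) :
  (#|T| * #|[set s : {perm T} | s a == b]| = #|{perm T}|)%N.
Proof.
have same_size c :
    #|[set s : {perm T} | s a == c]| = #|[set s : {perm T} | s a == b]|.
  rewrite -[RHS](card_imset _ (mulIg (tperm b c))); apply: eq_card => s.
  apply/idP/imsetP => [|[t]]; rewrite !inE.
    move=> /eqP sab; exists (s * tperm b c)%g; last by rewrite -mulgA tperm2 mulg1.
    by rewrite inE permM sab tpermR.
  by move=> /eqP tab ->; rewrite permM tab tpermL.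
transitivity (\sum_(c : T) #|[set s : {perm T} | s a == c]|)%N.
  by rewrite (eq_bigr _ (fun c _ => same_size c)) sum_nat_const.
rewrite -[RHS]sum1_card (partition_big (fun s : {perm T} => s a) predT) //=.
by apply: eq_bigr => c _; rewrite sum1dep_card.
Qed.

Lemma expected_graph_meet (R : realFieldType) (T : finType) (A : {set T * T}) :
  uniform_expectation
    (fun s : {perm T} => #|[set a | (a, s a) \in A]|%:R : R)
  = #|A|%:R / #|T|%:R.
Proof.
rewrite /uniform_expectation -natr_sum.
have -> : (\sum_(s : {perm T}) #|[set a | (a, s a) \in A]|
           = \sum_(p in A) #|[set s : {perm T} | s p.1 == p.2]|)%N.
  transitivity (\sum_(s : {perm T}) \sum_(a | (a, s a) \in A) 1)%N.
    by apply: eq_bigr => s _; rewrite sum1dep_card.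
  transitivity (\sum_(p in A) \sum_(s : {perm T} | s p.1 == p.2) 1)%N; last first.
    by apply: eq_bigr => p _; rewrite sum1dep_card.
  (* Both sides count the triples of a permutation, a point and its image. *)
  rewrite [RHS](exchange_big_dep predT) //=; apply: eq_bigr => s _.
  rewrite [RHS](reindex_onto (fun a => (a, s a)) fst) => [|[a b] /=].
    by apply: eq_bigl => a; rewrite /= !eqxx !andbT.
  by case/andP => _ /eqP ->.
have [/eqP T0|T_gt0] := posnP #|T|.
  (* Without points [A] is empty, and both sides are zero. *)
  have A0 : A = set0 by apply/setP => -[a b]; have := fintype0 a (eqP T0).
  by rewrite A0 big_set0 cards0 !mul0r.
have perm_gt0 : (0 < #|{perm T}|)%N by apply/card_gt0P; exists 1%g.
apply/eqP; rewrite eqr_div ?pnatr_eq0 -?lt0n // -!natrM eqr_nat.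
rewrite big_distrl /= -sum_nat_const.
by apply/eqP/eq_bigr => p _; rewrite mulnC card_perm_sending.
Qed.

Definition diagonal (n : nat) (k : int) : {set 'I_n * 'I_n} :=
  [set p : 'I_n * 'I_n | (p.1 : nat)%:Z - (p.2 : nat)%:Z == k].

Lemma card_diagonal_opp (n : nat) (k : int) :
  #|diagonal n (- k)| = #|diagonal n k|.
Proof.
have swapI : injective (fun p : 'I_n * 'I_n => (p.2, p.1)).
  by move=> [a b] [c d] [-> ->].
rewrite -(card_imset _ swapI); apply: eq_card => -[a b].
apply/imsetP/idP => [[[c d]]|]; rewrite !inE /=.
  by move=> cd [-> ->]; lia.
by move=> ab; exists (b, a); rewrite // inE /=; lia.
Qed.

(** For a nonnegative offset the cells of the diagonal are the pairs
    [(b + k, b)] with [b < n - k]; reflection gives the other offsets. *)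
Lemma card_diagonal (n : nat) (k : int) : #|diagonal n k| = (n - `|k|)%N.
Proof.
wlog [m ->] : k / exists m : nat, k = m%:Z.
  move=> nonneg; case: (boolP (0 <= k)) => k0.
    by apply: nonneg; exists `|k|%N; lia.
  by rewrite -card_diagonal_opp nonneg ?abszN //; exists `|k|%N; lia.
have cell_lt (b : 'I_(n - m)) : (b + m < n)%N by have := ltn_ord b; lia.
pose cell (b : 'I_(n - m)) := (Ordinal (cell_lt b), widen_ord (leq_subr m n) b).
have cellI : injective cell by move=> b c [_ /val_inj].
rewrite absz_nat -[RHS]card_ord -(card_imset _ cellI); apply: eq_card => -[a b].
apply/idP/imsetP => [|[c _ [-> ->]]]; rewrite inE /=; last by lia.
move=> ab; have b_lt : (b < n - m)%N by have := ltn_ord a; lia.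
exists (Ordinal b_lt) => //; congr pair; apply: val_inj => //=; lia.
Qed.

Theorem proposition2p5 (R : realFieldType) (n : nat) (i j : 'I_n) :
  uniform_expectation
    (fun s : 'S_n => n%:R^-1 * displacement_toeplitz R s i j)
  = n%:R^-1 * (1 - `|(i : nat)%:R - (j : nat)%:R| / n%:R).
Proof.
pose k : int := (i : nat)%:Z - (j : nat)%:Z.
have k_le : (`|k| <= n)%N by have := ltn_ord i; have := ltn_ord j; lia.
have n0 : n%:R != 0 :> R by rewrite pnatr_eq0; have := ltn_ord i; lia.
have normk : `|(i : nat)%:R - (j : nat)%:R| = `|k|%N%:R :> R.
  by rewrite natr_absz intr_norm rmorphB.
rewrite normk /uniform_expectation -mulr_sumr -mulrA; congr (_ * _).
have := expected_graph_meet R _ (diagonal n k).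
rewrite card_diagonal card_ord natrB // mulrBl divff // => <-.
rewrite /uniform_expectation; congr (_ / _); apply: eq_bigr => s _.
by rewrite mxE; congr (_%:R); apply: eq_card => a; rewrite !inE.
Qed.
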